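(* There exists a function $\varepsilon\colon \mathbb{N}\to\mathbb{R}$ with $\varepsilon(n)\to 0$ as $n\to\infty$ such that for every $n \geqslant 2$ there exists a language $L$ which is defined by a regular expression of size $n$, and which is also recognized by an NFA with $n-1$ states that remembers the last symbol, such that every DFA recognizing $L$ has at least $$2^{\frac{n}{2} + (1+\varepsilon(n)) \sqrt{2}\sqrt{\frac{n}{\ln n}}}$$ states.
   Context: Regular expressions over a finite alphabet $\Sigma$ are built inductively: each symbol $a\in\Sigma$ and $\emptyset$ are regular expressions, and if $\alpha,\beta$ are regular expressions then so are $(\alpha\beta)$ (concatenation), $(\alpha\mid\beta)$ (union) and $(\alpha)^*$ (Kleene star), with the standard semantics. The size of a regular expression is the number of occurrences of symbols of $\Sigma$ in it, counted with multiplicity. An NFA is a quintuple $(\Sigma,Q,Q_0,\delta,F)$ with set of initial states $Q_0\subseteq Q$, transition function $\delta\colon Q\times\Sigma\to 2^Q$ and accepting states $F$. An NFA remembers the last symbol if its state set is a disjoint union of subsets $Q_a$ ($a\in\Sigma$) with $\delta(q,a)\subseteq Q_a$ for all $q\in Q$, $a\in\Sigma$. A DFA is an NFA with one initial state and exactly one transition from each state by each symbol. *)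

(* Defs.v *)
From mathcomp Require Import all_boot.
From Stdlib Require Import Reals.

Set Implicit Arguments.
Unset Strict Implicit.
Unset Printing Implicit Defensive.

Section Automata.
Variable S : finType.

Inductive regex : Type :=
| RSym of S
| REmpty
| RCat of regex & regex
| RAlt of regex & regex
| RStar of regex.

Fixpoint re_size (r : regex) : nat :=
  match r with
  | RSym _ => 1
  | REmpty => 0
  | RCat r1 r2 => re_size r1 + re_size r2
  | RAlt r1 r2 => re_size r1 + re_size r2
  | RStar r1 => re_size r1
  end.

Inductive re_lang : regex -> seq S -> Prop :=
| L_sym a : re_lang (RSym a) [:: a]
| L_cat r1 r2 u v : re_lang r1 u -> re_lang r2 v -> re_lang (RCat r1 r2) (u ++ v)
| L_altl r1 r2 u : re_lang r1 u -> re_lang (RAlt r1 r2) u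
| L_altr r1 r2 u : re_lang r2 u -> re_lang (RAlt r1 r2) u
| L_star0 r : re_lang (RStar r) [::]
| L_starS r u v : re_lang r u -> re_lang (RStar r) v -> re_lang (RStar r) (u ++ v).

Record nfa (Q : finType) := NFA {
  n_init : {set Q};
  n_delta : Q -> S -> {set Q};
  n_final : {set Q} }.

Definition nfa_step (Q : finType) (A : nfa Q) (X : {set Q}) (a : S) : {set Q} :=
  \bigcup_(q in X) n_delta A q a.

Definition nfa_accepts (Q : finType) (A : nfa Q) (w : seq S) : bool :=
  [exists q in foldl (nfa_step A) (n_init A) w, q \in n_final A].

(* Q is the disjoint union of the Q_a (a in S), Q_a := lab^-1(a),
   with delta(q,a) included in Q_a. *)
Definition remembers_last (Q : finType) (A : nfa Q) : Prop :=
  exists lab : Q -> S, forall q a q', q' \in n_delta A q a -> lab q' = a.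

Record dfa (Q : finType) := DFA {
  d_init : Q;
  d_delta : Q -> S -> Q;
  d_final : {set Q} }.

Definition dfa_accepts (Q : finType) (D : dfa Q) (w : seq S) : bool :=
  foldl (d_delta D) (d_init D) w \in d_final D.

End Automata.

(* Main.v *)
Require Import Defs.
From mathcomp Require Import all_boot zify.
From Stdlib Require Import Reals Lra.
(* Reals shadows [^] on nat and [family]. *)
From mathcomp Require Import ssrnat finfun.

(** The language is a* (C_1^* | ... | C_k^* ), where, for pairwise coprime lengths p,
    C = (a^g | b) (b^* a)^(p-g) is a cycle with p occurrences of a and only p - g + 1
    occurrences of b.  On the nodes 0, ..., p-1 of the cycle, a is the rotation by one,
    while b fixes the nodes from g on, sends 0 to g and kills the other nodes below g.
    A long power of a makes all nodes of all cycles active; then, by the Chinese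
    remainder theorem, a^m b acts on each cycle as an independently chosen rotation
    followed by b.  A set that avoids the hole {0, ..., g-1} is fixed by b, so a cycle can
    wait, and moving the active nodes one after the other across the hole, while
    dropping some of them into it, produces every set that avoids the hole.  Rotating
    again, every set avoiding some block {mg, ..., mg+g-1} is reached; when p >= g 2^g
    these are at least half of the 2^p subsets, and further powers of a tell them apart.

    A cycle thus brings a factor 2^(p-1) to the number of states for a size of 2p - g + 1,
    that is, (g - 3) / 2 more than half of its size in the exponent.  Since g is an
    arbitrary constant, a crude Chebyshev bound on the number of primes suffices.  The
    size is brought up to n by one more cycle, whose length is coprime to the chosen K
    primes: these exceed K, hence K + 1 consecutive integers include such a length. *)

Set Implicit Arguments.
Unset Strict Implicit.
Unset Printing Implicit Defensive.

(** * Regular expressions *)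

Section RegexLang.
Variable S : finType.
Implicit Types (r : regex S) (u v w : seq S).

Lemma re_lang_sym (a : S) w : re_lang (RSym a) w <-> w = [:: a].
Proof. by split=> [H|->]; [inversion H | constructor]. Qed.

Lemma re_lang_empty w : ~ re_lang (REmpty S) w.
Proof. by move=> H; inversion H. Qed.

Lemma re_lang_cat r1 r2 w :
  re_lang (RCat r1 r2) w <->
  exists u v, [/\ w = u ++ v, re_lang r1 u & re_lang r2 v].
Proof.
split=> [H|[u [v [-> H1 H2]]]]; last exact: L_cat.
by inversion H as [|? ? u v Hu Hv| | | |]; exists u, v.
Qed.

Lemma re_lang_alt r1 r2 w : re_lang (RAlt r1 r2) w <-> re_lang r1 w \/ re_lang r2 w.
Proof.
split=> [H|[]]; first by inversion H; auto.
  exact: L_altl.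
exact: L_altr.
Qed.

Lemma re_lang_star_ind r (P : seq S -> Prop) :
  P [::] -> (forall u v, re_lang r u -> re_lang (RStar r) v -> P v -> P (u ++ v)) ->
  forall w, re_lang (RStar r) w -> P w.
Proof.
move=> P0 PS w; move eqs: (RStar r) => s H.
elim: H r eqs P0 PS => // r' u v Hu _ Hv IHv r [->] P0 PS.
by apply: (PS) => //; apply: (IHv r').
Qed.

Lemma re_lang_star_rcat r u v :
  re_lang (RStar r) u -> re_lang r v -> re_lang (RStar r) (u ++ v).
Proof.
move=> Hu Hv; elim/re_lang_star_ind: Hu => [|x y Hx _ IH]; last by rewrite -catA; apply: L_starS.
by rewrite -[_ ++ v]cats0; apply: L_starS => //; apply: L_star0.
Qed.

(** [RStar (REmpty S)] stands for the empty word, which has no constructor of its own, at size 0. *)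
Definition rpow r n : regex S := iter n (RCat r) (RStar (REmpty S)).

Lemma re_size_rpow r n : re_size (rpow r n) = n * re_size r.
Proof. by elim: n => //= n ->; rewrite mulSn. Qed.

Lemma re_lang_rpow0 r w : re_lang (rpow r 0) w <-> w = [::].
Proof.
split=> [|->]; last exact: L_star0.
by elim/re_lang_star_ind => // u v /re_lang_empty.
Qed.

Lemma re_lang_rpow_rcat r n u v :
  re_lang (rpow r n) u -> re_lang r v -> re_lang (rpow r n.+1) (u ++ v).
Proof.
elim: n u => [|n IH] u.
  move=> /re_lang_rpow0 -> Hv; rewrite -[_ ++ v]cats0; apply: L_cat => //; exact: L_star0.
by move=> /re_lang_cat [x [y [-> Hx Hy]]] Hv; rewrite -catA; apply: L_cat => //; apply: IH.
Qed.

Lemma re_lang_rpow_sym (a : S) n w : re_lang (rpow (RSym a) n) w <-> w = nseq n a.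
Proof.
elim: n w => [|n IH] w; first exact: re_lang_rpow0.
split=> [/re_lang_cat [u [v [-> /re_lang_sym -> /IH ->]]] //|->].
by rewrite -[nseq _ _]/([:: a] ++ nseq n a); apply: L_cat; [constructor|apply/IH].
Qed.

Lemma re_lang_star_sym (a : S) w :
  re_lang (RStar (RSym a)) w <-> exists n, w = nseq n a.
Proof.
split=> [|[n ->]].
  elim/re_lang_star_ind => [|u v /re_lang_sym -> _ [n ->]]; first by exists 0.
  by exists n.+1.
elim: n => [|n IH]; first exact: L_star0.
by rewrite -[nseq _ _]/([:: a] ++ nseq n a); apply: L_starS => //; constructor.
Qed.

(** The factor [REmpty S] annihilates the second alternative, which thus adds [d] to the size and no
    word to the language. *)
Definition rpad (a : S) r d : regex S := RAlt r (RCat (REmpty S) (rpow (RSym a) d)).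

Lemma re_size_rpad (a : S) r d : re_size (rpad a r d) = re_size r + d.
Proof. by rewrite /= re_size_rpow /= muln1. Qed.

Lemma re_lang_rpad (a : S) r d w : re_lang (rpad a r d) w <-> re_lang r w.
Proof.
split=> [/re_lang_alt [//|/re_lang_cat [u [v [_ /re_lang_empty]]]] //|H].
exact: L_altl.
Qed.

End RegexLang.

(* Glushkov's position automaton: the states are the occurrences of symbols. *)
Section Glushkov.
Variable S : finType.

(** [fst_] and [lst] mark the positions that can begin or end a word, [fol] the pairs that can be
    consecutive, and [nul] tells whether the empty word is accepted. *)
Record posaut (Q : finType) := PosAut {
  lab : Q -> S; fst_ : pred Q; lst : pred Q; fol : rel Q; nul : bool }.

Fixpoint acc Q (A : posaut Q) (q : Q) (w : seq S) : bool :=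
  if w is a :: w' then [exists q', [&& fol A q q', lab A q' == a & acc A q' w']]
  else lst A q.

Definition plang Q (A : posaut Q) (w : seq S) : bool :=
  if w is a :: w' then [exists q, [&& fst_ A q, lab A q == a & acc A q w']]
  else nul A.

Definition represents (r : regex S) :=
  exists (Q : finType) (A : posaut Q),
    #|Q| = re_size r /\ forall w, plang A w <-> re_lang r w.

Lemma accP Q (A : posaut Q) q a w :
  reflect (exists q', [/\ fol A q q', lab A q' = a & acc A q' w]) (acc A q (a :: w)).
Proof.
apply: (iffP existsP) => [[q' /and3P[? /eqP ? ?]]|[q' [? /eqP ? ?]]]; exists q' => //.
exact/and3P.
Qed.

Lemma plangP Q (A : posaut Q) a w :
  reflect (exists q, [/\ fst_ A q, lab A q = a & acc A q w]) (plang A (a :: w)).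
Proof.
apply: (iffP existsP) => [[q' /and3P[? /eqP ? ?]]|[q' [? /eqP ? ?]]]; exists q' => //.
exact/and3P.
Qed.

Section Combine.
Variables (Q1 Q2 : finType) (A1 : posaut Q1) (A2 : posaut Q2).

Definition sum_case T (f1 : Q1 -> T) (f2 : Q2 -> T) (q : Q1 + Q2) : T :=
  match q with inl x => f1 x | inr y => f2 y end.

Definition pos_alt : posaut (Q1 + Q2)%type :=
  PosAut (sum_case (lab A1) (lab A2)) (sum_case (fst_ A1) (fst_ A2))
    (sum_case (lst A1) (lst A2))
    (fun p q => match p, q with
      | inl x, inl y => fol A1 x y | inr x, inr y => fol A2 x y | _, _ => false end)
    (nul A1 || nul A2).

Definition pos_cat : posaut (Q1 + Q2)%type :=
  PosAut (sum_case (lab A1) (lab A2))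
    (sum_case (fst_ A1) (fun y => nul A1 && fst_ A2 y))
    (sum_case (fun x => lst A1 x && nul A2) (lst A2))
    (fun p q => match p, q with
      | inl x, inl y => fol A1 x y | inr x, inr y => fol A2 x y
      | inl x, inr y => lst A1 x && fst_ A2 y | _, _ => false end)
    (nul A1 && nul A2).

Definition pos_star : posaut Q1 :=
  PosAut (lab A1) (fst_ A1) (lst A1)
    (fun x y => fol A1 x y || lst A1 x && fst_ A1 y) true.

Lemma acc_alt w :
  (forall q, acc pos_alt (inl q) w = acc A1 q w) /\
  (forall q, acc pos_alt (inr q) w = acc A2 q w).
Proof.
elim: w => [//|a w [IH1 IH2]]; split=> q; apply/accP/accP.
- by move=> [[x|x] [//= ? ? ?]]; exists x; rewrite -IH1.
- by move=> [x [? ? ?]]; exists (inl x); rewrite IH1.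
- by move=> [[x|x] [//= ? ? ?]]; exists x; rewrite -IH2.
- by move=> [x [? ? ?]]; exists (inr x); rewrite IH2.
Qed.

Lemma plang_alt w : plang pos_alt w = plang A1 w || plang A2 w.
Proof.
case: w => [//|a w]; have [IH1 IH2] := acc_alt w.
apply/plangP/orP.
- by move=> [[x|x] [/= ? ? H]]; [left|right]; apply/plangP; exists x; rewrite -?IH1 -?IH2.
- by move=> [/plangP|/plangP] [x [? ? ?]]; [exists (inl x)|exists (inr x)]; rewrite /= ?IH1 ?IH2.
Qed.

Lemma acc_catr w q : acc pos_cat (inr q) w = acc A2 q w.
Proof.
elim: w q => [//|a w IH] q; apply/accP/accP.
- by move=> [[x|x] [//= ? ? ?]]; exists x; rewrite -IH.
- by move=> [x [? ? ?]]; exists (inr x); rewrite IH.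
Qed.

Lemma acc_catl w q :
  acc pos_cat (inl q) w <-> exists u v, [/\ w = u ++ v, acc A1 q u & plang A2 v].
Proof.
elim: w q => [|a w IH] q.
  split=> [/andP[? ?]|[[|? ?] [[|? ?] [] // _ ? ?]]]; last exact/andP.
  by exists [::], [::].
split=> [/accP[[x|x] [/= H1 H2 H3]]|].
- have [u [v [-> ? ?]]] := (IH x).1 H3; exists (a :: u), v; split=> //.
  by apply/accP; exists x.
- move: H1 => /andP[? ?]; exists [::], (a :: w); split=> //.
  by apply/plangP; exists x; rewrite -acc_catr.
- move=> [[|c u] [v [E Hu Hv]]]; apply/accP.
    move: E Hv => /= <- /plangP[x [? ? ?]]; exists (inr x); rewrite acc_catr; split=> //.
    exact/andP.
  case: E => ? ?; subst c w; move: Hu => /accP[x [? ? ?]]; exists (inl x); split=> //.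
  by apply/IH; exists u, v.
Qed.

Lemma plang_cat w :
  plang pos_cat w <-> exists u v, [/\ w = u ++ v, plang A1 u & plang A2 v].
Proof.
case: w => [|a w].
  split=> [/andP[? ?]|[[|? ?] [[|? ?] [] // _ ? ?]]]; last exact/andP.
  by exists [::], [::].
split=> [/plangP[[x|x] [/= H1 H2 H3]]|].
- have [u [v [-> ? ?]]] := (acc_catl w x).1 H3; exists (a :: u), v; split=> //.
  by apply/plangP; exists x.
- move: H1 => /andP[? ?]; exists [::], (a :: w); split=> //.
  by apply/plangP; exists x; rewrite -acc_catr.
- move=> [[|c u] [v [E Hu Hv]]]; apply/plangP.
    move: E Hv => /= <- /plangP[x [? ? ?]]; exists (inr x); rewrite acc_catr; split=> //.
    exact/andP.
  case: E => ? ?; subst c w; move: Hu => /plangP[x [? ? ?]]; exists (inl x); split=> //.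
  by apply/acc_catl; exists u, v.
Qed.

Variable r : regex S.
Hypothesis A1P : forall w, plang A1 w <-> re_lang r w.

(** Here [u] completes the iteration in progress at [q], and [v] consists of the later
    iterations. *)
Lemma acc_star w q :
  acc pos_star q w <->
  exists u v, [/\ w = u ++ v, acc A1 q u & re_lang (RStar r) v].
Proof.
split.
  elim: w q => [|a w IH] q; first by exists [::], [::]; split=> //; exact: L_star0.
  move=> /accP[x [/= Hf Hl /IH [u [v [-> Hu Hv]]]]].
  move/orP: Hf => [Hf1|/andP[? ?]].
    by exists (a :: u), v; split=> //; apply/accP; exists x.
  exists [::], (a :: u ++ v); split=> //.
  by rewrite -cat_cons; apply: L_starS => //; apply/A1P/plangP; exists x.
have acc_nil u x : acc A1 x u -> acc pos_star x u.
  elim: u x => [//|a u IH] x /accP[y [H1 H2 H3]]; apply/accP; exists y.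
  by rewrite /= H1; split=> //; apply: IH.
(* The jump from a last position to a first one begins a new iteration. *)
have acc_cons u x y z : acc A1 x u -> fst_ A1 y -> acc pos_star y z ->
    acc pos_star x (u ++ lab A1 y :: z).
  move=> Hu Hy Hz; elim: u x Hu => [|a u IH] x.
    by rewrite cat0s => Hx; apply/accP; exists y; rewrite /= [lst A1 x]Hx Hy orbT.
  rewrite cat_cons => /accP[x' [H1 H2 H3]]; apply/accP; exists x'; rewrite /= H1.
  by split=> //; apply: IH.
move=> [u [v [-> Hu Hv]]]; elim/re_lang_star_ind: Hv q u Hu {w} => [|x y Hx _ IH] q u Hu.
  by rewrite cats0; apply: acc_nil.
case: x Hx => [_|a x /A1P/plangP[q' [H1 <- H3]]]; first exact: IH.
by rewrite cat_cons; apply: acc_cons => //; apply: IH.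
Qed.

Lemma plang_star w : plang pos_star w <-> re_lang (RStar r) w.
Proof.
case: w => [|a w]; first by split=> // _; exact: L_star0.
split=> [/plangP[q [H1 H2 /acc_star [u [v [-> Hu Hv]]]]]|].
  by rewrite -cat_cons; apply: L_starS => //; apply/A1P/plangP; exists q.
move eqw: (a :: w) => x Hx; elim/re_lang_star_ind: Hx a w eqw => [//|[|c u] v Hu Hv IH] a w.
  exact: IH.
case=> ? ?; subst a w; apply/plangP; move/A1P/plangP: Hu => [q [? ? ?]]; exists q; split=> //.
by apply/acc_star; exists u, v.
Qed.

End Combine.

Lemma represents_regex r : represents r.
Proof.
elim: r => [a||r1 [Q1 [A1 [C1 H1]]] r2 [Q2 [A2 [C2 H2]]]
  |r1 [Q1 [A1 [C1 H1]]] r2 [Q2 [A2 [C2 H2]]]|r [Q [A [C H]]]].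
- exists unit, (PosAut (fun=> a) predT predT (fun _ _ => false) false).
  split=> [|w]; first by rewrite card_unit.
  rewrite re_lang_sym; case: w => [//|c w].
  split=> [/plangP[[] [_ /= <-]]|[<- ->]]; last by apply/plangP; exists tt.
  by case: w => [//|? ?] /accP[? []].
- exists void, (PosAut (fun x : void => match x with end) pred0 pred0 (fun _ _ => false) false).
  split=> [|w]; first by rewrite card_void.
  by split=> [|/re_lang_empty //]; case: w => [//|c w] /plangP[[]].
- exists _, (pos_cat A1 A2); split=> [|w]; first by rewrite card_sum C1 C2.
  rewrite plang_cat re_lang_cat.
  by split=> -[u [v [? /H1 ? /H2 ?]]]; exists u, v.
- exists _, (pos_alt A1 A2); split=> [|w]; first by rewrite card_sum C1 C2.
  rewrite plang_alt re_lang_alt.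
  by split=> [/orP[/H1|/H2]|[/H1|/H2] ->]; rewrite ?orbT; auto.
- by exists _, (pos_star A); split=> // w; apply: plang_star.
Qed.

(** A position is entered only by reading its own label, so the automaton remembers the last symbol.
    The extra state [None] is initial and never entered, so its label [s0] is arbitrary. *)
Lemma regex_nfa (s0 : S) (r : regex S) :
  exists (Q : finType) (A : nfa S Q),
    [/\ #|Q| = (re_size r).+1, remembers_last A &
        forall w, nfa_accepts A w <-> re_lang r w].
Proof.
have [Q [A [C H]]] := represents_regex r.
pose step (o : option Q) := if o is Some q then fol A q else fst_ A.
pose fin (o : option Q) := if o is Some q then lst A q else nul A.
pose N := NFA [set None] (fun o a => [set Some q | q : Q & step o q && (lab A q == a)])
  [set o | fin o].
exists (option Q), N; split=> [||w]; first by rewrite card_option C.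
  exists (fun o => if o is Some q then lab A q else s0) => o a q' /imsetP[q].
  by rewrite inE => /andP[_ /eqP <-] ->.
rewrite -H; suff accN X : [exists o in foldl (nfa_step N) X w, o \in n_final N] =
    [exists o in X, if o is Some q then acc A q w else plang A w].
  rewrite /nfa_accepts accN; split=> [/existsP[o]|Hw]; first by rewrite !inE => /andP[/eqP ->].
  by apply/existsP; exists None; rewrite !inE.
elim: w X => [|a w IH] X.
  by apply: eq_existsb => o; rewrite inE; case: o.
rewrite /= IH; apply/existsP/existsP => [[o /andP[/bigcupP[o' Ho' /imsetP[q Hq ->]] Hw]]|].
  exists o'; rewrite Ho'; move: Hq; rewrite inE => /andP[Hs Hl].
  by case: o' {Ho'} Hs => [q'|] /= Hs; apply/existsP; exists q; rewrite Hs Hl.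
move=> [o' /andP[Ho' Hw]].
have [q [Hs Hl Hq]] : exists q, [/\ step o' q, lab A q = a & acc A q w].
  by case: o' {Ho'} Hw => [q'|] /existsP[q /and3P[? /eqP ? ?]]; exists q.
exists (Some q); rewrite Hq andbT; apply/bigcupP; exists o' => //.
by apply/imsetP; exists q; rewrite // inE Hs Hl eqxx.
Qed.

End Glushkov.

(** * A single cycle *)

Local Notation la := (RSym true).
Local Notation lb := (RSym false).

Definition cyc (g p : nat) : regex bool :=
  RCat (RAlt (rpow la g) lb) (rpow (RCat (RStar lb) la) (p - g)).

Lemma re_size_cyc g p : re_size (cyc g p) = g.+1 + (p - g) * 2.
Proof. by rewrite /= !re_size_rpow /= muln1 addn1. Qed.

Section Cycle.
Variables (g p : nat).
Hypotheses (g1 : 1 < g) (gp : g < p).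
Implicit Types (X Y Z : nat -> bool) (w : seq bool).

(* A set of nodes of the cycle is a p-periodic predicate on nat, so that the
   letter a shifts it by one, subtraction being replaced by addition of p - 1. *)
Definition cstep X (c : bool) : nat -> bool :=
  if c then fun j => X (j + p.-1)
  else fun j => (g <= j %% p) && X j || (j %% p == g) && X 0.

Definition run X w := foldl cstep X w.

Definition point s : nat -> bool := fun j => j == s %[mod p].

Definition periodic X := forall i j, i = j %[mod p] -> X i = X j.

Definition hole X := forall j, j < g -> X j = false.

Lemma run_cat X u v : run X (u ++ v) = run (run X u) v.
Proof. exact: foldl_cat. Qed.

Lemma eq_cstep X Y c : X =1 Y -> cstep X c =1 cstep Y c.
Proof. by move=> E j; case: c; rewrite /= !E. Qed.

Lemma eq_run X Y w : X =1 Y -> run X w =1 run Y w.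
Proof. by elim: w X Y => [//|c w IH] X Y E; apply/IH/eq_cstep. Qed.

Lemma run_mono X Y w : (forall j, X j -> Y j) -> forall j, run X w j -> run Y w j.
Proof.
elim: w X Y => [//|c w IH] X Y E; apply: IH => j; case: c => /=; first exact: E.
by move=> /orP[/andP[-> /E ->//]|/andP[-> /E ->]]; rewrite orbT.
Qed.

Lemma run_has (T : Type) (s : seq T) (F : T -> nat -> bool) w :
  run (fun j => has (F^~ j) s) w =1 fun j => has (fun t => run (F t) w j) s.
Proof.
elim: w F => [//|c w IH] F j; rewrite /= -(IH (fun t => cstep (F t) c)).
apply: eq_run => {}j; case: c => //=.
elim: s {IH} => /= [|t s <-]; first by rewrite !andbF.
by case: (g <= _) (_ == g) => [] []; case: (F _ _) (F t 0) => [] []; rewrite ?orbT ?orbF ?andbF.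
Qed.

Lemma cstep_periodic X c : periodic X -> periodic (cstep X c).
Proof.
move=> PX i j E; case: c => /=; last by rewrite E (PX _ _ E).
by apply: PX; rewrite -modnDml E modnDml.
Qed.

Lemma run_periodic X w : periodic X -> periodic (run X w).
Proof. by elim: w X => [//|c w IH] X PX; apply/IH/cstep_periodic. Qed.

Lemma periodic_mod X j : periodic X -> X (j %% p) = X j.
Proof. by apply; rewrite modn_mod. Qed.

Lemma periodic_eq X Y : periodic X -> periodic Y ->
  (forall j, j < p -> X j = Y j) -> X =1 Y.
Proof.
move=> PX PY E j; rewrite -(periodic_mod _ PX) -(periodic_mod _ PY); apply: E.
by rewrite ltn_mod; lia.
Qed.

Lemma point_periodic s : periodic (point s).
Proof. by move=> i j E; rewrite /point E. Qed.

Lemma run_a X r j : run X (nseq r true) j = X (j + r * p.-1).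
Proof.
elim: r X => [|r IH] X /=; first by rewrite addn0.
by rewrite -/(run _ _) IH /=; congr X; lia.
Qed.

Lemma run_aD X r j : periodic X -> run X (nseq r true) (j + r) = X j.
Proof.
move=> PX; rewrite run_a; apply: PX.
by rewrite (_ : j + r + r * p.-1 = r * p + j) ?modnMDl //; lia.
Qed.

Lemma run_a_mod X r s : periodic X -> r = s %[mod p] ->
  run X (nseq r true) =1 run X (nseq s true).
Proof.
by move=> PX E j; rewrite !run_a; apply: PX; rewrite -modnDmr -modnMml E modnMml modnDmr.
Qed.

Definition go s w e := run (point s) w e.

(** After [u] the active nodes include [m], and runs are monotone. *)
Lemma go_trans s u m v e : go s u m -> go m v e -> go s (u ++ v) e.
Proof.
rewrite /go run_cat => H; apply: run_mono => j /eqP E.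
by rewrite (run_periodic u (point_periodic s) E).
Qed.

Lemma go_a j : go j [:: true] j.+1.
Proof. by apply/eqP; rewrite (_ : j.+1 + _ = p + j) ?modnDl //; lia. Qed.

Lemma go_an n : go 0 (nseq n true) n.
Proof.
elim: n => [|n IH]; first exact/eqP.
by rewrite -addn1 nseqD; apply: (go_trans IH); rewrite addn1; apply: go_a.
Qed.

Lemma go_b j : g <= j < p -> go j [:: false] j.
Proof. by move=> /andP[? ?]; rewrite /go /= modn_small // /point eqxx; lia. Qed.

Lemma go_b0 : go 0 [:: false] g.
Proof. by rewrite /go /= modn_small // /point !eqxx orbT. Qed.

Lemma cyc_go w : re_lang (RStar (cyc g p)) w -> go 0 w 0.
Proof.
elim/re_lang_star_ind => [|u v Hu _ IH]; first exact/eqP.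
apply: (go_trans _ IH).
rewrite /go -(run_periodic u (point_periodic 0) (i := p)); last by rewrite modnn mod0n.
move/re_lang_cat: Hu => [x [y [-> Hx Hy]]]; apply: (@go_trans _ _ g).
  move/re_lang_alt: Hx => [/re_lang_rpow_sym|/re_lang_sym] ->; [exact: go_an|exact: go_b0].
(* Each factor waits at a node [j] with [g <= j < p], where b is a loop, and then advances by
   one. *)
have Hgen : forall n j, g <= j -> j + n <= p -> forall y,
    re_lang (rpow (RCat (RStar lb) la) n) y -> go j y (j + n).
  elim=> [|n IHn] j gj jn {Hy}y; first by move=> /re_lang_rpow0 ->; rewrite addn0; apply/eqP.
  move=> /re_lang_cat[x0 [z [-> /re_lang_cat[x1 [x2 [-> Hx1 /re_lang_sym ->]]] Hz]]].
  apply: (@go_trans _ _ j.+1); last by rewrite addnS -addSn; apply: IHn => //; lia.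
  apply: (go_trans _ (go_a j)).
  elim/re_lang_star_ind: Hx1 => [|? ? /re_lang_sym -> _ IHx]; first exact/eqP.
  by apply: (go_trans _ IHx); apply: go_b; lia.
by move: (Hgen (p - g) g (leqnn g)); rewrite subnKC; [apply|lia].
Qed.

(* The words leading from node 0 to node j without completing the cycle. *)
Definition upto j : regex bool :=
  if j < g then rpow la j
  else RCat (RAlt (rpow la g) lb) (RCat (rpow (RCat (RStar lb) la) (j - g)) (RStar lb)).

(** Induction on the last letter. Letter a enters [j] from its predecessor on the cycle; letter b
    enters it from [j] itself, when [g <= j], or from 0, when [j = g]. *)
Lemma go_cyc w j : j < p -> go 0 w j -> re_lang (RCat (RStar (cyc g p)) (upto j)) w.
Proof.
elim/last_ind: w j => [|w c IH] j jp.
  rewrite /go /= /point !modn_small //; last lia.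
  move=> /eqP ->; rewrite -[[::]]cats0; apply: L_cat; first exact: L_star0.
  by rewrite /upto ifT; [exact/re_lang_rpow0|lia].
rewrite /go -cats1 run_cat; have PR := run_periodic w (point_periodic 0).
case: c => /=.
  (* Entering node 0 from [p - 1] closes the cycle, so the part of the word described by [upto]
     becomes one more factor of the star. *)
  case: j jp => [|j] jp.
    rewrite add0n => /IH-/(_ ltac:(lia)) /re_lang_cat[u [v [-> Hu Hv]]].
    rewrite -catA -[_ ++ _]cats0; apply: L_cat; last first.
      by rewrite /upto ifT; [exact/re_lang_rpow0|lia].
    apply: re_lang_star_rcat => //.
    move: Hv; rewrite /upto ifF; last lia.
    move=> /re_lang_cat[x [y [-> Hx /re_lang_cat[z [t [-> Hz Ht]]]]]].
    rewrite -!catA; apply: L_cat => //.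
    rewrite (_ : p - g = (p.-1 - g).+1); last lia.
    by apply: re_lang_rpow_rcat => //; apply: L_cat => //; constructor.
  rewrite (PR _ j); last by rewrite (_ : _ + _ = p + j) ?modnDl; lia.
  move=> /IH-/(_ ltac:(lia)) /re_lang_cat[u [v [-> Hu Hv]]].
  rewrite -catA; apply: L_cat => //; move: Hv; rewrite /upto.
  case: (ltnP j.+1 g) => jg.
    by rewrite ifT; [move=> Hv; apply: re_lang_rpow_rcat => //; constructor|lia].
  (* If [j < g], then [j.+1 = g]: the power a^g is complete, and [upto] changes from its first form
     to its second. *)
  case: (ltnP j g) => jg'.
    move=> Hv; rewrite (_ : j.+1 - g = 0); last lia.
    rewrite -[_ ++ _]cats0; apply: L_cat.
      apply: L_altl; rewrite (_ : g = j.+1); last lia.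
      by apply: re_lang_rpow_rcat => //; constructor.
    by rewrite -[[::]]cats0; apply: L_cat; [exact/re_lang_rpow0|exact: L_star0].
  move=> /re_lang_cat[x [y [-> Hx /re_lang_cat[z [t [-> Hz Ht]]]]]].
  rewrite -!catA; apply: L_cat => //; rewrite subSn // [z ++ _]catA -[_ ++ _]cats0.
  apply: L_cat; last exact: L_star0.
  by rewrite -catA; apply: re_lang_rpow_rcat => //; apply: L_cat => //; constructor.
rewrite modn_small // => /orP[/andP[gj /IH-/(_ jp)]|/andP[/eqP -> /IH]].
  move=> /re_lang_cat[u [v [-> Hu]]]; rewrite /upto ifF; last lia.
  move=> /re_lang_cat[x [y [-> Hx /re_lang_cat[z [t [-> Hz Ht]]]]]].
  rewrite -!catA; do 3!apply: L_cat => //.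
  by apply: re_lang_star_rcat => //; constructor.
move=> /(_ ltac:(lia)) /re_lang_cat[u [v [-> Hu]]]; rewrite /upto ltnn ifT; last lia.
move=> /re_lang_rpow0 ->; rewrite cats0; apply: L_cat => //.
rewrite -[[:: false]]cats0; apply: L_cat; first by apply: L_altr; constructor.
rewrite subnn -[[::]]cats0; apply: L_cat; [exact/re_lang_rpow0|exact: L_star0].
Qed.

Lemma cycP w : re_lang (RStar (cyc g p)) w <-> run (point 0) w 0.
Proof.
split; first exact: cyc_go.
move=> /(@go_cyc w 0 ltac:(lia)) /re_lang_cat[u [v [-> Hu]]].
rewrite /upto ifT; last lia.
by move=> /re_lang_rpow0 ->; rewrite cats0.
Qed.

Lemma run_full_a n w : run (point 0) (nseq n true ++ w) 0 -> run predT w 0.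
Proof. by rewrite run_cat; apply: run_mono. Qed.

(** The full set is the union of the rotations of node 0 by fewer than [p] steps, and runs commute
    with unions. *)
Lemma run_full_ex w : run predT w 0 -> exists2 n, n < p & run (point 0) (nseq n true ++ w) 0.
Proof.
rewrite (@eq_run _ (fun j => has (fun t => run (point 0) (nseq t true) j) (iota 0 p))).
  rewrite run_has => /hasP[t]; rewrite mem_iota => /andP[_ tp] H.
  by exists t => //; rewrite run_cat.
move=> j; apply/esym/hasP; exists (j %% p); first by rewrite mem_iota ltn_mod; lia.
by rewrite -(periodic_mod j (run_periodic _ (point_periodic 0))); apply: go_an.
Qed.

(** * Sets of nodes reached by the moves a^r b *)

Definition op X r := cstep (run X (nseq r true)) false.

Lemma op_hole X r : hole (op X r).
Proof. by move=> j jg; rewrite /op /= modn_small; lia. Qed.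

Lemma op_periodic X r : periodic X -> periodic (op X r).
Proof. by move=> PX; apply/cstep_periodic/run_periodic. Qed.

Lemma op0 X : periodic X -> hole X -> op X 0 =1 X.
Proof.
move=> PX HX; apply: periodic_eq => // [|j jp]; first exact: op_periodic.
rewrite /op /= modn_small // (HX 0) ?andbF ?orbF; last lia.
by case: leqP => //= jg; rewrite HX.
Qed.

(** A node at [p - 1] rotates to 0 and then jumps to [g], thus crossing the hole in a single
    move. *)
Lemma op1 X j : periodic X -> hole X -> g <= j < p ->
  op X 1 j = if j == g then X p.-1 else X j.-1.
Proof.
move=> PX HX /andP[gj jp]; rewrite /op /= modn_small // gj /= add0n.
have -> : X (j + p.-1) = X j.-1.
  by apply: PX; rewrite (_ : j + p.-1 = p + j.-1) ?modnDl //; lia.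
by case: eqP => [->|_] /=; rewrite ?orbF // HX //; lia.
Qed.

(** This is the backward rotation. A node at [g] goes to [g - 1], which is not 0 because [1 < g],
    and is killed there. *)
Lemma opN1 X j : periodic X -> hole X -> g <= j < p ->
  op X p.-1 j = if j == p.-1 then false else X j.+1.
Proof.
move=> PX HX /andP[gj jp]; have PR := run_periodic (nseq p.-1 true) PX.
have E i : run X (nseq p.-1 true) i = X i.+1.
  rewrite -(run_aD p.-1 i.+1 PX); apply: PR.
  by rewrite (_ : i.+1 + _ = p + i) ?modnDl //; lia.
rewrite /op /= modn_small // gj /= !E (HX 1) // andbF orbF; case: eqP => // ->.
rewrite prednK; last lia.
by rewrite (PX p 0) ?HX ?modnn ?mod0n //; lia.
Qed.

Definition ops := foldl op (op predT 0).

Lemma ops_rcons rs r : ops (rcons rs r) = op (ops rs) r.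
Proof. exact: foldl_rcons. Qed.

Lemma ops_hole rs : hole (ops rs).
Proof. by case/lastP: rs => [|rs r]; rewrite ?ops_rcons; apply: op_hole. Qed.

Lemma ops_periodic rs : periodic (ops rs).
Proof.
elim/last_ind: rs => [|rs r IH]; rewrite ?ops_rcons; apply: op_periodic => //.
Qed.

(* Each element in turn is moved across the hole by [op _ 1]; if it has to be erased,
   [op _ p.-1] lets it fall into the hole and [op _ 1] moves the hole back. *)
Lemma ops_surj_rec Z k : k <= p - g -> exists rs, forall j, g <= j < p ->
  ops rs j = if j < g + k then Z (j + p - g - k) else true.
Proof.
elim: k => [|k IH] kp.
  by exists [::] => j /andP[gj jp]; rewrite /ops /= /op /= modn_small // gj ifF //; lia.
have [rs Hrs] := IH ltac:(lia); set X := ops rs.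
have PX := ops_periodic rs; have HX := ops_hole rs.
(* Since [k < p - g], position [p - 1] still holds an untreated active node; after the move it sits
   at [g], to be kept or erased according to [Z (p - k.+1)]. *)
have E1 j : g <= j < p ->
    op X 1 j = if j == g then true else if j < g + k.+1 then Z (j + p - g - k.+1) else true.
  move=> gjp; rewrite op1 //; case: eqP => jg.
    by rewrite /X Hrs; [rewrite ifF //; lia|lia].
  rewrite /X Hrs; last lia.
  by rewrite (_ : (j.-1 < g + k) = (j < g + k.+1)); [case: ifP => // _; congr Z; lia|lia].
have [Zk|Zk] := boolP (Z (p - k.+1)).
  exists (rcons rs 1) => j gjp; rewrite ops_rcons E1 //; case: eqP => // ->.
  by rewrite ifT; [rewrite (_ : g + p - g - k.+1 = p - k.+1) ?Zk //; lia|lia].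
exists (rcons (rcons (rcons rs 1) p.-1) 1) => j gjp; rewrite !ops_rcons -/X.
have P1 := op_periodic 1 PX; have P2 := op_periodic p.-1 P1.
rewrite op1 //; last exact: op_hole.
case: eqP => [->|jg].
  rewrite opN1 ?eqxx; [|done|exact: op_hole|lia].
  rewrite ifT; last lia.
  by rewrite (_ : g + p - g - k.+1 = p - k.+1); [apply/esym/negbTE|lia].
rewrite opN1; [|done|exact: op_hole|lia].
rewrite ifF; last lia.
by rewrite prednK ?E1; [rewrite ifF //; lia| |]; lia.
Qed.

Lemma ops_surj Z : periodic Z -> hole Z -> exists rs, ops rs =1 Z.
Proof.
move=> PZ HZ; have [rs Hrs] := @ops_surj_rec Z (p - g) (leqnn _).
exists rs; apply: periodic_eq => // [|j jp]; first exact: ops_periodic.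
case: (ltnP j g) => jg; first by rewrite ops_hole // HZ.
by rewrite Hrs ?jg // ifT; [congr Z; lia|lia].
Qed.

End Cycle.

(** * Several cycles run in parallel *)

Lemma chinese_seq (I : eqType) (p r : I -> nat) (s : seq I) : uniq s ->
  (forall i j, i != j -> coprime (p i) (p j)) ->
  exists m, forall i, i \in s -> m = r i %[mod p i].
Proof.
move=> us cop; elim: s us => [|i s IH] /=; first by exists 0.
move=> /andP[is_ us]; have [m Hm] := IH us.
have cP : coprime (p i) (\prod_(j <- s) p j).
  elim: s is_ {us IH Hm} => [|j s IH]; first by rewrite big_nil coprimen1.
  by rewrite inE negb_or big_cons coprimeMr => /andP[ij /IH ->]; rewrite cop.
exists (chinese (p i) (\prod_(j <- s) p j) (r i) m) => j; rewrite inE.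
case/predU1P => [->|js]; first exact: chinese_modl.
rewrite -(Hm j js); have dv : p j %| \prod_(j <- s) p j by rewrite (big_rem j) //= dvdn_mulr.
by rewrite -(modn_dvdm _ dv) chinese_modr // modn_dvdm.
Qed.

(** * Counting the sets of nodes that avoid a block *)

Section Blocks.
Variables (g p : nat).
Hypotheses (g0 : 0 < g) (gp : 2 ^ g <= p %/ g).

Definition has_node (Y : {set 'I_p}) (j : nat) := [exists x in Y, (x : nat) == j %% p].

(** Only blocks starting at multiples of [g] are considered: they are disjoint, so the sets meeting
    all of them are counted by a product. *)
Definition zero_block (Y : {set 'I_p}) :=
  [exists m : 'I_(p %/ g), forall x : 'I_p, (m * g <= x < m * g + g) ==> (x \notin Y)].

Lemma has_node_ord Y (x : 'I_p) : has_node Y x = (x \in Y).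
Proof.
rewrite /has_node modn_small //; apply/existsP/idP => [[y /andP[Hy /eqP /val_inj <-]] //|Hx].
by exists x; rewrite Hx eqxx.
Qed.

Lemma has_node_mod Y j k : j = k %[mod p] -> has_node Y j = has_node Y k.
Proof. by rewrite /has_node => ->. Qed.

(** Bernoulli's inequality (1 + 1/d)^M >= 1 + M/d >= 2, with denominators cleared. *)
Lemma expn_succ_double d M : 0 < d <= M -> 2 * d ^ M <= d.+1 ^ M.
Proof.
move=> /andP[d0 dM]; rewrite -(leq_pmul2l d0).
have bern m : (d + m) * d ^ m <= d * d.+1 ^ m.
  elim: m => [|m IH]; first by rewrite addn0.
  rewrite !expnS; nia.
by apply: leq_trans (bern M); rewrite mulnA leq_mul2r; apply/orP; right; lia.
Qed.

(** A set is encoded by its traces on the [M] blocks and on the remainder. If no block is avoided,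
    all the traces on blocks are nonempty, which leaves at most (2^g - 1)^M 2^(p - M g) sets; this
    is at most half of 2^p because [2 ^ g <= M]. *)
Lemma card_zero_block : 2 ^ p.-1 <= #|[pred Y | zero_block Y]|.
Proof.
set M := p %/ g; have Mp : M * g <= p by exact: leq_divM.
have p0 : 0 < p.
  by rewrite lt0n; apply: contraTneq gp => ->; rewrite div0n -ltnNge expn_gt0.
pose enc (Y : {set 'I_p}) := ([ffun m : 'I_M => [set i : 'I_g | has_node Y (m * g + i)]],
  [set i : 'I_(p - M * g) | has_node Y (M * g + i)]).
pose B := setX [set f : {ffun 'I_M -> {set 'I_g}} | f \in ffun_on (predC1 (@set0 'I_g))]
  [set: {set 'I_(p - M * g)}].
have inj : injective enc.
  move=> Y Z /pair_equal_spec [/ffunP E1 /setP E2]; apply/setP => x; rewrite -!has_node_ord.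
  case: (ltnP x (M * g)) => xM.
    have xg : x %/ g < M by rewrite ltn_divLR.
    have := E1 (Ordinal xg); rewrite !ffunE => /setP/(_ (Ordinal (ltn_pmod x g0))).
    by rewrite !inE /= -divn_eq.
  have xM' : x - M * g < p - M * g by have := ltn_ord x; lia.
  by have := E2 (Ordinal xM'); rewrite !inE /= subnKC.
have sub : enc @: [set Y | ~~ zero_block Y] \subset B.
  apply/subsetP => _ /imsetP[Y + ->]; rewrite inE => bad.
  rewrite !inE andbT; apply/ffun_onP => m; rewrite ffunE !inE.
  apply: contra bad => /eqP/setP E; apply/existsP; exists m; apply/forallP => x.
  apply/implyP => /andP[x1 x2]; have xm : x - m * g < g by rewrite ltn_subLR.
  by have := E (Ordinal xm); rewrite !inE /= subnKC // has_node_ord => ->.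
have card_set q : #|{: {set 'I_q}}| = 2 ^ q.
  by rewrite -cardsT -powersetT card_powerset cardsT card_ord.
have cB : #|B| = (2 ^ g).-1 ^ M * 2 ^ (p - M * g).
  by rewrite cardsX cardsT card_set cardsE card_ffun_on cardC1 !card_set card_ord.
have /subset_leq_card := sub; rewrite card_imset // cB => le.
have tot : #|[set Y | ~~ zero_block Y]| + #|[pred Y | zero_block Y]| = 2 ^ p.
  rewrite -card_set -(cardC [pred Y | zero_block Y]) addnC.
  by congr (_ + _); rewrite cardsE.
have dbl : 2 * (2 ^ g).-1 ^ M <= 2 ^ (M * g).
  have e0 : 0 < 2 ^ g by rewrite expn_gt0.
  rewrite [M * g]mulnC expnM -[X in _ <= X ^ _](prednK e0); apply: expn_succ_double.
  have e1 : 2 ^ 1 <= 2 ^ g by rewrite leq_exp2l.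
  by rewrite -[2 ^ 1]/2 in e1; rewrite /M; lia.
have E : 2 ^ p = 2 ^ (M * g) * 2 ^ (p - M * g) by rewrite -expnD subnKC.
have E' : 2 ^ p = 2 * 2 ^ p.-1 by rewrite -expnS prednK.
nia.
Qed.

End Blocks.

Section Union.
Variables (I : finType) (g : nat) (p : I -> nat).
Hypotheses (g1 : 1 < g) (gp : forall i, 2 ^ g <= p i %/ g)
  (cop : forall i j, i != j -> coprime (p i) (p j)).

Let gp' i : g < p i.
Proof.
have h := gp i; have g0 : 0 < g by lia.
by have := ltn_expl g (isT : 1 < 2); have := leq_divM (p i) g; nia.
Qed.

Definition cycs : regex bool :=
  RCat (RStar la) (foldr (fun i r => RAlt (RStar (cyc g (p i))) r) (REmpty bool) (enum I)).

Lemma re_size_cycs : re_size cycs = (\sum_i (g.+1 + (p i - g) * 2)).+1.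
Proof.
rewrite /= add1n -big_enum; congr _.+1.
by elim: (enum I) => [|i s IH]; rewrite ?big_nil // big_cons -IH -re_size_cyc.
Qed.

(** The factor a* may absorb any number of the [M] leading letters, so every node of every cycle can
    be the current one when the first b is read. *)
Lemma re_lang_cycs w M : (forall i, p i <= M) ->
  re_lang cycs (nseq M true ++ false :: w) <->
  exists i, run g (p i) predT (false :: w) 0.
Proof.
move=> pM.
have altP v : re_lang (foldr (fun i r => RAlt (RStar (cyc g (p i))) r) (REmpty bool) (enum I)) v
    <-> exists i, re_lang (RStar (cyc g (p i))) v.
  have E : (exists i, re_lang (RStar (cyc g (p i))) v) <->
      exists2 i, i \in enum I & re_lang (RStar (cyc g (p i))) v.
    by split=> [[i H]|[i _ H]]; exists i; rewrite ?mem_enum.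
  rewrite {}E; elim: (enum I) => [|i s IH] /=; first by split=> [/re_lang_empty|[]].
  rewrite re_lang_alt IH; split=> [[H|[j js H]]|[j]].
  - by exists i; rewrite ?mem_head.
  - by exists j; rewrite ?inE ?js ?orbT.
  - by rewrite inE => /predU1P[->|js] H; [left|right; exists j].
split=> [/re_lang_cat[u [v [E /re_lang_star_sym [n Eu] /altP[i Hi]]]]|[i Hi]].
  (* The factor a* cannot absorb the letter b, so the split falls within the leading power. *)
  exists i; have [t Et] : exists t, v = nseq t true ++ false :: w.
    rewrite {}Eu {pM Hi altP} in E; elim: n M E => [|n IH] [|M] //=.
    - by exists 0.
    - by move=> <-; exists M.+1.
    - by case=> /IH.
  by move: Hi; rewrite {}Et => /(cycP g1 (gp' i)); apply: run_full_a.
have [n np Hn] := run_full_ex g1 (gp' i) Hi.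
rewrite (_ : nseq M true = nseq (M - n) true ++ nseq n true); last first.
  by rewrite -nseqD; congr nseq; have := pM i; lia.
rewrite -catA; apply: L_cat; first by apply/re_lang_star_sym; exists (M - n).
by apply/altP; exists i; apply/(cycP g1 (gp' i)).
Qed.

(** At each step a single exponent, given by the Chinese remainder theorem, performs the prescribed
    rotation on every cycle. *)
Lemma run_ops_simul (rs : I -> seq nat) :
  exists w, forall i, run g (p i) predT (false :: w) =1 ops g (p i) (rs i).
Proof.
have gen (r : I -> nat -> nat) n :
    exists w, forall i, run g (p i) predT (false :: w) =1 ops g (p i) (mkseq (r i) n).
  elim: n => [|n [w IH]]; first by exists [::].
  have [m Hm] := chinese_seq (r^~ n) (enum_uniq I) cop.
  exists (w ++ nseq m true ++ [:: false]) => i j.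
  rewrite -cat_cons catA !run_cat mkseqS ops_rcons; apply: eq_cstep => {}j.
  rewrite (eq_run g (p i) _ (IH i)); apply: (run_a_mod g1 (gp' i)); first exact: ops_periodic.
  by apply: Hm; rewrite mem_enum.
pose n := \max_i size (rs i).
have [w Hw] := gen (fun i => nth 0 (rs i)) n; exists w => i j; rewrite {}Hw.
(* The default value 0 pads the shorter sequences with moves that are idle by [op0]. *)
have -> : mkseq (nth 0 (rs i)) n = rs i ++ nseq (n - size (rs i)) 0.
  have le : size (rs i) <= n by exact: (leq_bigmax i).
  apply: (@eq_from_nth _ 0); first by rewrite size_cat size_nseq size_mkseq subnKC.
  move=> k; rewrite size_mkseq => kn; rewrite nth_mkseq // nth_cat nth_nseq.
  by case: ltnP => // h; rewrite if_same nth_default.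
elim: (_ - _) j => [|k IH] j; first by rewrite cats0.
rewrite -addn1 nseqD catA cats1 ops_rcons op0 //; [exact: ops_periodic|exact: ops_hole].
Qed.

Let P := \max_i p i.

(** On each cycle the avoided block is first placed at the hole; one last power of a then rotates
    all the cycles to their required positions. *)
Lemma reach_config (X : {dffun forall i, {set 'I_(p i)}}) :
  (forall i, zero_block g (X i)) ->
  exists w, forall i (x : 'I_(p i)), run g (p i) predT (false :: w) x = (x \in X i).
Proof.
move=> zX.
have [m Hm] : exists m : I -> nat, forall i, m i * g + g <= p i /\
    forall x : 'I_(p i), m i * g <= x < m i * g + g -> x \notin X i.
  suff : forall i, exists m, m * g + g <= p i /\
      forall x : 'I_(p i), m * g <= x < m * g + g -> x \notin X i.
    by move=> /fin_all_exists.
  move=> i; have /existsP[m /forallP Hm] := zX i; exists m; split.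
    by have := leq_divM (p i) g; have := ltn_ord m; nia.
  by move=> x Hx; apply: (implyP (Hm x)).
pose Z i j := has_node (X i) (j + m i * g).
have PZ i : periodic (p i) (Z i).
  by move=> j k E; apply: has_node_mod; rewrite -modnDml E modnDml.
have HZ i : hole g (Z i).
  move=> j jg; have [mp mX] := Hm i; have jp : j + m i * g < p i by lia.
  rewrite /Z -[_ + _]/(Ordinal jp : nat) has_node_ord; apply/negbTE/mX => /=; lia.
have [rs Hrs] : exists rs : I -> seq nat, forall i, ops g (p i) (rs i) =1 Z i.
  suff : forall i, exists rs, ops g (p i) rs =1 Z i by move=> /fin_all_exists.
  by move=> i; apply: (ops_surj g1 (gp' i)).
have [w Hw] := run_ops_simul rs.
have [n Hn] := chinese_seq (fun i => m i * g) (enum_uniq I) cop.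
exists (w ++ nseq n true) => i x.
have -> : run g (p i) predT (false :: w ++ nseq n true) x =
    run g (p i) (Z i) (nseq (m i * g) true) x.
  rewrite -cat_cons run_cat (eq_run g (p i) _ (Hw i)) (eq_run g (p i) _ (Hrs i)).
  by apply: (run_a_mod g1 (gp' i)); [exact: PZ|apply: Hn; rewrite mem_enum].
rewrite -has_node_ord (run_a g1 (gp' i)) /Z; apply: has_node_mod.
by rewrite -addnA -mulnSr prednK; [rewrite addnC modnMDl|have := gp' i; lia].
Qed.

(** Distinct configurations in [F] lead to distinct states: if [x] lies in [X i] but not in [Y i],
    some power of a brings to node 0 the node [x] of cycle [i] and, on every other cycle, a node
    outside [Y]. Only [X] then leads to acceptance. *)
Lemma cycs_dfa (Q : finType) (D : dfa bool Q) :
  (forall w, dfa_accepts D w <-> re_lang cycs w) ->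
  2 ^ (\sum_i (p i).-1) <= #|Q|.
Proof.
move=> HD; pose T := {dffun forall i, {set 'I_(p i)}}.
pose good i := [pred Y : {set 'I_(p i)} | zero_block g Y].
pose F := family good.
have gF (X : T) : X \in F -> forall i, zero_block g (X i) by move=> /familyP.
have [W HW] : exists W : T -> seq bool, forall X, X \in F -> forall i (x : 'I_(p i)),
    run g (p i) predT (false :: W X) x = (x \in X i).
  suff : forall X, exists w, X \in F -> forall i (x : 'I_(p i)),
    run g (p i) predT (false :: w) x = (x \in X i).
    exact: (@fin_all_exists {dffun forall i, {set 'I_(p i)}} (fun=> seq bool)).
  move=> X.
  have [/gF/reach_config [w Hw]|_] := boolP (X \in F); last by exists [::].
  by exists w.
pose q X := foldl (d_delta D) (d_init D) (nseq P true ++ false :: W X).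
have sep X Y i (x : 'I_(p i)) : X \in F -> Y \in F -> q X = q Y ->
    x \in X i -> x \in Y i.
  move=> FX FY E Hx; apply/negPn/negP => HnY.
  have [h Hh] : exists h : forall j, 'I_(p j), h i = x /\ forall j, h j \notin Y j.
    (* The clause on [i = j] forces the value [x] at [i] across the dependent type, so that the
       nodes can be chosen cycle by cycle. *)
    suff : forall j, exists y : 'I_(p j), y \notin Y j /\
        forall e : i = j, y = cast_ord (congr1 p e) x.
      move=> /fin_all_exists[h Hh]; exists h; split; last by move=> j; have [] := Hh j.
      by have [_ ->] := Hh i; apply: val_inj.
    move=> j; case: (eqVneq i j) => [<-|ij].
      by exists x; split=> // e; apply: val_inj.
    have /existsP[m /forallP Hm] := gF _ FY j.
    have mp : m * g < p j by have := leq_divM (p j) g; have := ltn_ord m; nia.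
    exists (Ordinal mp); split; last by move=> e; rewrite e eqxx in ij.
    by apply: (implyP (Hm (Ordinal mp))) => /=; lia.
  have [n Hn] := chinese_seq (fun j => p j - h j) (enum_uniq I) cop.
  have test Z : Z \in F ->
      dfa_accepts D ((nseq P true ++ false :: W Z) ++ nseq n true) <-> exists j, h j \in Z j.
    move=> FZ; rewrite HD -catA cat_cons re_lang_cycs; last by move=> j; apply: leq_bigmax.
    have E0 j : run g (p j) predT (false :: W Z ++ nseq n true) 0 = (h j \in Z j).
      have gj := gp' j; have pj0 : 0 < p j by lia.
      have PR : periodic (p j) (run g (p j) predT (false :: W Z)) by apply: run_periodic.
      rewrite -cat_cons run_cat (run_a_mod g1 gj (s := p j - h j) PR); last first.
        by apply: Hn; rewrite mem_enum.
      rewrite -(run_periodic g _ PR (i := h j + (p j - h j))); last first.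
        by rewrite subnKC ?modnn ?mod0n // ltnW.
      by rewrite (run_aD g1 gj) // HW.
    by split=> [[j]|[j Hj]]; [rewrite E0; exists j|exists j; rewrite E0].
  have : exists j, h j \in Y j.
    apply/test => //; rewrite /dfa_accepts foldl_cat -/(q Y) -E /q -foldl_cat.
    by apply/test => //; exists i; rewrite Hh.1.
  by case=> j; apply/negP; case: Hh.
have inj : {in F &, injective q}.
  move=> X Y FX FY E; apply/ffunP => i; apply/setP => x.
  by apply/idP/idP; apply: sep.
have le := leq_card_in q F inj; apply: (leq_trans _ le); rewrite card_family.
have -> : foldr muln 1 [seq #|good i| | i : I] = \prod_i #|good i|.
  by rewrite foldrE big_image.
rewrite expn_sum; apply: leq_prod => i _.
by apply: card_zero_block => //; lia.
Qed.

End Union.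

(** * Primes *)

(** In Vandermonde's sum for the central coefficient, one of the two binomial factors is bounded
    below by 1. *)
Lemma leq_exp2_central_bin m : 2 ^ m <= 'C(m + m, m).
Proof.
rewrite -Vandermonde -[2]/(1 + 1) expnDn; apply: leq_sum => i _.
rewrite !exp1n !muln1 leq_pmulr // bin_gt0; exact: leq_subr.
Qed.

Lemma divn_double m d : 0 < d -> (m + m) %/ d <= m %/ d + m %/ d + 1.
Proof.
move=> d0; rewrite -ltnS ltn_divLR //.
have := divn_eq m d; have := ltn_pmod m d0; nia.
Qed.

(** By Legendre's formula the exponent is a sum of differences between the quotient of 2m by q^k and
    twice that of m. Each is at most 1, and it vanishes once q^k > 2m. *)
Lemma logn_central_bin q m : prime q -> 0 < m ->
  logn q 'C(m + m, m) <= trunc_log q (m + m).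
Proof.
move=> pq m0; have q1 := prime_gt1 pq; set t := trunc_log q (m + m).
have fact2 : logn q (m + m)`! = logn q 'C(m + m, m) + (logn q m`! + logn q m`!).
  have := bin_fact (leq_addl m m); rewrite addnK => <-.
  by rewrite !lognM ?muln_gt0 ?fact_gt0 // bin_gt0 leq_addl.
(* Zero terms extend the sum for [m] to the range of the sum for [m + m]. *)
have ext : logn q m`! = \sum_(1 <= k < (m + m).+1) m %/ q ^ k.
  rewrite logn_fact // [RHS](@big_cat_nat _ _ _ m.+1) //=; last by rewrite ltnS leq_addl.
  rewrite [X in _ = _ + X]big_nat_cond [X in _ = _ + X]big1 ?addn0 // => k /andP[/andP[mk _] _].
  by rewrite divn_small // (leq_trans mk) // ltnW // ltn_expl.
have tle : \sum_(1 <= k < (m + m).+1) (k <= t : nat) <= t.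
  suff gen n : \sum_(1 <= k < n.+1) (k <= t : nat) = minn n t by rewrite gen geq_minr.
  elim: n => [|n IH]; first by rewrite big_geq // min0n.
  by rewrite big_nat_recr //= IH; case: (leqP n.+1 t); lia.
suff : logn q (m + m)`! <= logn q m`! + logn q m`! + t by lia.
rewrite logn_fact // {1 2}ext -!big_split /=; apply: leq_trans (leq_add (leqnn _) tle).
rewrite -big_split /=; apply: leq_sum => k _.
case: (leqP k t) => kt; first by apply: divn_double; rewrite expn_gt0; lia.
rewrite divn_small // (leq_trans (trunc_log_ltn (m + m) q1)) //.
by rewrite leq_exp2l.
Qed.

(** With m = 2^(e-1), the central binomial coefficient is at least 2^m, while each of its prime
    power factors is at most 2m = 2^e. *)
Lemma chebyshev e : 0 < e ->
  2 ^ e.-1 <= e * size [seq q <- iota 0 (2 ^ e).+1 | prime q].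
Proof.
move=> e0; set m := 2 ^ e.-1; set A := filter _ _.
have m0 : 0 < m by rewrite expn_gt0.
have mm : m + m = 2 ^ e by rewrite addnn -mul2n -expnS prednK.
rewrite -(leq_exp2l _ _ (isT : 1 < 2)); apply: leq_trans (leq_exp2_central_bin m) _.
set N := 'C(m + m, m); have N0 : 0 < N by rewrite bin_gt0 leq_addl.
have sub : {subset primes N <= A}.
  move=> q; rewrite mem_primes => /and3P[pq _ dv].
  rewrite mem_filter pq mem_iota /= add0n ltnS -mm leqNgt; apply/negP => lt.
  have : q %| (m + m)`! by rewrite -(bin_fact (leq_addl m m)) dvdn_mulr.
  elim: (m + m) lt => [|k IH] lt; first by rewrite dvdn1 => /eqP E; rewrite E in pq.
  rewrite factS Euclid_dvdM // => /orP[/dvdn_leq|]; [lia|apply: IH; lia].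
rewrite expnM -mm [X in X <= _](prod_prime_decomp N0) prime_decompE big_map /=.
apply: (@leq_trans (\prod_(q <- primes N) (m + m))).
  rewrite big_seq [X in _ <= X]big_seq; apply: leq_prod => q.
  rewrite mem_primes => /and3P[pq _ _]; have q1 := prime_gt1 pq.
  apply: leq_trans (trunc_logP q1 (_ : 0 < m + m)); last by rewrite addn_gt0 m0.
  by rewrite leq_exp2l // logn_central_bin.
rewrite big_const_seq count_predT iter_muln muln1 leq_pexp2l ?addn_gt0 ?m0 //.
exact: uniq_leq_size (primes_uniq N) sub.
Qed.

Lemma many_primes b e k : 0 < e -> e * (k + b) < 2 ^ e.-1 ->
  exists s : seq nat, [/\ size s = k, uniq s &
    forall q : nat, q \in s -> [/\ prime q, b < q & q <= 2 ^ e]].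
Proof.
move=> e0 lt; have := chebyshev e0; set A := filter _ _ => le.
have sA : k + b < size A by rewrite -(ltn_pmul2l e0) (leq_trans lt).
have uA : uniq A by rewrite filter_uniq ?iota_uniq.
pose A' := [seq q <- A | b < q]; have uA' : uniq A' by rewrite filter_uniq.
have kA' : k <= size A'.
  have E : size A' + size [seq q <- A | predC (ltn b) q] = size A.
    by rewrite -(count_predC (ltn b) A) -!size_filter.
  (* The strict inequality in [sA] makes up for the extra number 0 among the [b.+1] numbers up to
     [b]. *)
  suff : size [seq q <- A | predC (ltn b) q] <= b.+1 by lia.
  rewrite -[X in _ <= X](size_iota 0 b.+1); apply: uniq_leq_size; first by rewrite filter_uniq.
  by move=> q; rewrite mem_filter mem_iota /= -leqNgt add0n ltnS => /andP[].
exists (take k A'); split; [by rewrite size_takel|exact: take_uniq|].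
move=> q /mem_take; rewrite !mem_filter mem_iota => /and3P[-> -> /=].
by rewrite add0n ltnS.
Qed.

(** Pigeonhole: otherwise one of the primes divides two numbers of the window, whose difference is
    at most [size s], hence smaller than that prime. *)
Lemma coprime_in_window v0 (s : seq nat) :
  (forall q : nat, q \in s -> prime q /\ size s < q) ->
  exists2 v, v0 <= v <= v0 + size s & forall q : nat, q \in s -> coprime q v.
Proof.
move=> Hs; have [/existsP[i /allP Hi]|/existsPn bad] :=
    boolP [exists i : 'I_(size s).+1, all (fun q => ~~ (q %| v0 + i)) s].
  exists (v0 + i); first by have := ltn_ord i; lia.
  by move=> q qs; rewrite prime_coprime ?Hi //; have [] := Hs q qs.
have [f Hf] : exists f : 'I_(size s).+1 -> 'I_(size s), forall i, nth 0 s (f i) %| v0 + i.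
  suff : forall i : 'I_(size s).+1, exists j : 'I_(size s), nth 0 s j %| v0 + i.
    by move=> /fin_all_exists.
  move=> i; have /allPn[q qs] := bad i; rewrite negbK -index_mem in qs * => dv.
  by exists (Ordinal qs); rewrite /= nth_index // -index_mem.
suff inj : injective f by have := leq_card f inj; rewrite !card_ord ltnn.
have ord_le (i j : 'I_(size s).+1) : f i = f j -> i <= j -> i = j.
  move=> E ij; have [_ lt] := Hs _ (mem_nth 0 (ltn_ord (f i))).
  have : nth 0 s (f i) %| (v0 + j) - (v0 + i) by rewrite dvdn_sub // E.
  rewrite subnDl; have [/eqP|pos] := posnP (j - i).
    by rewrite subn_eq0 => ji _; apply/val_inj/anti_leq/andP.
  move=> /(dvdn_leq pos) le; have := leq_trans lt (leq_trans le (leq_subr i j)).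
  by rewrite ltnNge -ltnS ltn_ord.
move=> i j E; have [ij|/ltnW ji] := leqP i j; first exact: ord_le.
by apply/esym/ord_le.
Qed.

(** Each of the [K] prime cycles gains [g - 3] in twice the exponent over its size. The uncertainty
    [K] in the length of the additional cycle costs at most [2 * K], which leaves [K * (g - 5)]. *)
Lemma hard_regex g n e : let K := 2 ^ e %/ (8 * e) in
  5 < g -> 0 < e -> 4 * e * (g * 2 ^ g + 3) < 2 ^ e -> 4 ^ e <= n * e ->
  exists (r : regex bool) (E : nat),
    [/\ re_size r + 2 <= n, n + K * (g - 5) <= 2 * E + 6 &
      forall (Q : finType) (D : dfa bool Q),
        (forall w, dfa_accepts D w <-> re_lang r w) -> 2 ^ E <= #|Q|].
Proof.
move=> K g5 e0; set B := g * 2 ^ g => eB en.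
have Ke : K * (8 * e) <= 2 ^ e by exact: leq_divM.
clearbody K.
have E4 : 4 ^ e = 2 ^ e * 2 ^ e by rewrite -expnMn.
have E2 : 2 ^ e = 2 * 2 ^ e.-1 by rewrite -expnS prednK.
have n2e : 2 ^ e <= n.
  by have := ltn_expl e (isT : 1 < 2); rewrite E4 in en; nia.
have [s [sK us Hs]] : exists s : seq nat, [/\ size s = K, uniq s &
    forall q : nat, q \in s -> [/\ prime q, K + B < q & q <= 2 ^ e]].
  (* Both 2 e K and e B are at most 2^e / 4, the latter strictly. Exceeding [K] serves
     [coprime_in_window]; exceeding [B] gives [2 ^ g] blocks. *)
  apply: many_primes => //; nia.
pose cost q := g.+1 + (q - g) * 2; pose S := \sum_(q <- s) cost q.
have gB : g < B by rewrite /B; have := ltn_expl g (isT : 1 < 2); nia.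
have S4 : 4 * S <= n.
  have : S <= K * (2 * 2 ^ e).
    rewrite /S -sK mulnC -iter_addn_0 -count_predT -big_const_seq big_seq [X in _ <= X]big_seq.
    by apply: leq_sum => q /Hs[_ ? ?]; rewrite /cost; lia.
  rewrite E4 in en => S2; rewrite -(leq_pmul2r e0); nia.
(* A cycle of length v has size 2v - g + 1, so even the top [v0 + K] of the window keeps the total
   size at most [n - 2]. *)
pose v0 := (n - 3 - S) %/ 2 - K.
have [v /andP[v0v vK] cv] : exists2 v, v0 <= v <= v0 + size s &
    forall q : nat, q \in s -> coprime q v.
  by apply: coprime_in_window => q /Hs[? ? _]; split=> //; rewrite sK; lia.
rewrite sK in vK.
pose p (i : 'I_K.+1) := nth 0 (v :: s) i.
have nB : 4 * (B + 3) <= n by nia.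
have nK : 8 * K <= n by nia.
have Bv : B <= v by rewrite /v0 in v0v; lia.
have sum_p (f : nat -> nat) : \sum_i f (p i) = f v + \sum_(q <- s) f q.
  transitivity (\sum_(q <- v :: s) f q); last by rewrite big_cons.
  by rewrite (big_nth 0) big_mkord /= sK.
have in_s i : i < K -> nth 0 s i \in s by move=> iK; rewrite mem_nth // sK.
have cop i j : i != j -> coprime (p i) (p j).
  case: i j => [[|i] iK] [[|j] jK] //= ij; rewrite /p /=.
  - by rewrite coprime_sym cv // in_s.
  - by rewrite cv // in_s.
  have [pi _ _] := Hs _ (in_s i iK); have [pj _ _] := Hs _ (in_s j jK).
  by rewrite prime_coprime // dvdn_prime2 // nth_uniq ?sK.
have gp i : 2 ^ g <= p i %/ g.
  have g0 : 0 < g by lia.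
  rewrite leq_divRL // mulnC -/B; case: i => [[|i] iK] //=.
  by have [_ + _] := Hs _ (in_s i iK); rewrite /p /=; lia.
exists (cycs g p), (\sum_i (p i).-1); split; last first.
- by move=> Q D; apply: cycs_dfa => //; lia.
- rewrite (sum_p predn).
  have : S + K * (g - 3) = 2 * \sum_(q <- s) q.-1.
    rewrite -sK mulnC -iter_addn_0 -count_predT -big_const_seq -big_split /= big_distrr /=.
    rewrite big_seq [RHS]big_seq; apply: eq_bigr => q /Hs[_ ? _]; rewrite /cost; lia.
  rewrite /v0 in v0v; nia.
- rewrite re_size_cycs (sum_p cost) -/S.
  rewrite /v0 in vK; rewrite /cost; lia.
Qed.

(** * The numerical estimates *)

(** For [e] at least [c + 5], c e < e^2 <= 2^e. *)
Lemma linear_lt_exp2 c : exists2 e0, 0 < e0 & forall e, e0 <= e -> c * e < 2 ^ e.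
Proof.
exists (c + 5) => [|e le]; first by rewrite addn_gt0 orbT.
suff sq m : (m + 4) * (m + 4) <= 2 ^ (m + 4).
  by have := sq (e - 4); rewrite subnK; [nia|lia].
by elim: m => [|m IH] //; rewrite addSn expnS; nia.
Qed.

(** The scale makes 2^e of order sqrt(n ln n), so that about 2^e / e cycles of length up to 2^e have
    total size of order n. *)
Lemma exists_scale e0 n : 0 < e0 -> 4 ^ e0 <= n ->
  exists e, [/\ e0 <= e, 4 ^ e <= n * e & n * e.+1 < 4 ^ e.+1].
Proof.
move=> e00 le; pose P e := (e0 <= e) && (n * e.+1 < 4 ^ e.+1).
have exP : exists e, P e.
  exists (n + e0); rewrite /P leq_addl (_ : 4 = 2 * 2) // expnMn.
  by apply: ltn_mul; [apply: leq_trans (ltn_expl _ (isT : 1 < 2)); lia|apply: ltn_expl].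
have [e /andP[e0e lt] min] := ex_minnP exP; exists e; split=> //.
move: e0e; rewrite leq_eqVlt => /predU1P[<-|lt0]; first by apply: leq_trans le _; nia.
rewrite leqNgt; apply/negP => lt'; have := min e.-1.
rewrite /P prednK; last lia.
by rewrite lt' andbT; lia.
Qed.

Lemma INR_exp2 m : INR (2 ^ m) = Rpower 2 (INR m).
Proof.
rewrite Rpower_pow; last lra.
elim: m => [//|m IH]; rewrite expnS mult_INR IH /=; lra.
Qed.

(** From 2^e <= n and ln 2 > 1/2 follows ln n >= e/2, hence 2n / ln n <= 4n / e <= y^2. *)
Lemma exponent_bound n e y E : 0 < e -> 2 ^ e <= n -> 4 * n <= e * (y * y) ->
  n + 2 * y <= 2 * E ->
  (INR n / 2 + sqrt 2 * sqrt (INR n / ln (INR n)) <= INR E)%R.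
Proof.
move=> e0 en ny nE.
have ln2 := ln_lt_2.
have le_INR' a b : a <= b -> (INR a <= INR b)%R by move=> /leP/le_INR.
have eR : (0 < INR e)%R by apply/lt_0_INR/ltP.
have lnE : (INR e / 2 <= ln (INR n))%R.
  apply: (Rle_trans _ (ln (INR (2 ^ e)))).
    rewrite INR_exp2 /Rpower ln_exp; nra.
  have [lt|->] := Rle_lt_or_eq_dec _ _ (le_INR' _ _ en); last exact: Rle_refl.
  by apply/Rlt_le/ln_increasing => //; apply/lt_0_INR/ltP; rewrite expn_gt0.
have := le_INR' _ _ ny; have := le_INR' _ _ nE.
rewrite plus_INR !mult_INR /= => nER nyR.
have n0 := pos_INR n; have y0 := pos_INR y.
suff : (sqrt 2 * sqrt (INR n / ln (INR n)) <= INR y)%R by lra.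
have q0 : (0 <= INR n / ln (INR n))%R.
  by apply: Rmult_le_pos => //; apply/Rlt_le/Rinv_0_lt_compat; lra.
rewrite -sqrt_mult //; last lra.
rewrite -(sqrt_square (INR y)) //; apply: sqrt_le_1_alt.
have l0 : (0 < ln (INR n))%R by lra.
apply: (Rmult_le_reg_r (ln (INR n))) => //.
rewrite (_ : (2 * (INR n / ln (INR n)) * ln (INR n) = 2 * INR n)%R); last by field; lra.
have : (0 <= INR y * INR y)%R by apply: Rmult_le_pos.
nra.
Qed.

Lemma large_case : exists n0, forall n, n0 <= n ->
  exists r : regex bool, re_size r + 2 <= n /\
    forall (Q : finType) (D : dfa bool Q),
      (forall w, dfa_accepts D w <-> re_lang r w) ->
      (Rpower 2 (INR n / 2 + sqrt 2 * sqrt (INR n / ln (INR n))) <= INR #|Q|)%R.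
Proof.
(* [g - 5 >= 128] makes the gain [K * (g - 5) / 2] exceed the required exponent although
   [K] is chosen far below the best possible number of primes. *)
have [g g133] : exists g, 133 <= g by exists 133.
have [e0 e00 He0] := linear_lt_exp2 (4 * (g * 2 ^ g + 3)).
exists (4 ^ e0) => n le; have [e [e0e en ne]] := exists_scale e00 le.
have eB : 4 * e * (g * 2 ^ g + 3) < 2 ^ e by rewrite mulnAC He0.
have epos : 0 < e by lia.
have [r [E [rn nE HD]]] := hard_regex (ltac:(lia) : 5 < g) epos eB en.
exists r; split=> // Q D /HD le_Q.
have E4 : 4 ^ e = 2 ^ e * 2 ^ e by rewrite -expnMn.
apply: (Rle_trans _ (INR (2 ^ E))); last exact/le_INR/leP.
rewrite INR_exp2; apply: Rle_Rpower; first lra.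
set K := 2 ^ e %/ (8 * e) in nE.
have KE : 2 ^ e < K.+1 * (8 * e) by rewrite ltn_ceil; lia.
clearbody K.
have gB : 133 <= g * 2 ^ g by have := expn_gt0 2 g; nia.
have e133 : 532 * e < 2 ^ e by nia.
have n2 : 2 ^ e <= n by rewrite E4 in en; nia.
(* Here [64 * K - 3] is half of [128 * K - 6], a lower bound for the gain of [hard_regex] less its
   loss of 6. Squaring the inequality gives 4 n e < 16 * 4^e <= (e y)^2 for y = 64 K - 3. *)
have Ky : 4 * 2 ^ e <= e * (64 * K - 3) by nia.
apply: (@exponent_bound n e (64 * K - 3)) => //; last by nia.
rewrite -(leq_pmul2l epos); move: ne; rewrite expnS E4; nia.
Qed.

(** Two paddings of [r0] are used: the expression is padded to size [n], whereas the automaton comes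
    from a padding to size [n - 2], its initial state being the one additional state. *)
Lemma padded_regex_nfa (S : finType) (a : S) (r0 : regex S) n : re_size r0 + 2 <= n ->
  exists r : regex S, [/\ re_size r = n,
    exists (Q : finType) (A : nfa S Q), #|Q| = n.-1 /\ remembers_last A /\
      (forall w, nfa_accepts A w <-> re_lang r w) &
    forall w, re_lang r w <-> re_lang r0 w].
Proof.
move=> rn; exists (rpad a r0 (n - re_size r0)); split; first by rewrite re_size_rpad; lia.
  have [Q [A [cQ rA HA]]] := regex_nfa a (rpad a r0 (n - 2 - re_size r0)).
  exists Q, A; split; first by rewrite cQ re_size_rpad; lia.
  by split=> // w; rewrite HA !re_lang_rpad.
by move=> w; apply: re_lang_rpad.
Qed.

Theorem theorem2 :
  exists eps : nat -> R, Un_cv eps 0%R /\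
  forall n : nat, 2 <= n ->
  exists (S : finType) (r : regex S),
    re_size r = n /\
    (exists (Q : finType) (A : nfa S Q),
        #|Q| = n.-1 /\ remembers_last A /\
        (forall w, nfa_accepts A w <-> re_lang r w)) /\
    (forall (Q : finType) (D : dfa S Q),
        (forall w, dfa_accepts D w <-> re_lang r w) ->
        (Rpower 2 (INR n / 2 + (1 + eps n) * sqrt 2 * sqrt (INR n / ln (INR n)))
           <= INR #|Q|)%R).
Proof.
have [n0 Hn0] := large_case.
pose c n := (sqrt 2 * sqrt (INR n / ln (INR n)))%R.
(* From [n0] on the bound holds without correction. Below [n0] this value makes the whole exponent
   0, and a DFA has at least one state. *)
exists (fun n => if n0 <= n then 0%R else (- 1 - INR n / 2 / c n)%R); split.
  move=> d d0; exists n0 => n /leP ->.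
  by rewrite /R_dist Rminus_diag Rabs_R0.
move=> n n2; exists bool.
suff [r0 [rn HD]] : exists r : regex bool, re_size r + 2 <= n /\
    forall (Q : finType) (D : dfa bool Q),
      (forall w, dfa_accepts D w <-> re_lang r w) ->
      (Rpower 2 (INR n / 2 + (1 + if (n0 <= n)%N then 0 else - 1 - INR n / 2 / c n)
        * sqrt 2 * sqrt (INR n / ln (INR n))) <= INR #|Q|)%R.
  have [r [sz nfa_r Lr]] := padded_regex_nfa true rn.
  exists r; split=> //; split=> // Q D H; apply: (HD Q D) => w; rewrite H; exact: Lr.
case: (leqP n0 n) => [/Hn0 [r [rn HD]]|_].
  by exists r; split=> // Q D /HD; rewrite Rplus_0_r Rmult_1_l.
exists (REmpty bool); split=> // Q D _.
have cpos : (0 < c n)%R.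
  have n1 : (1 < INR n)%R by apply: (lt_INR 1); apply/ltP.
  have l0 : (0 < ln (INR n))%R by rewrite -ln_1; apply: ln_increasing; lra.
  apply: Rmult_lt_0_compat; apply: sqrt_lt_R0; first lra.
  by apply: Rdiv_lt_0_compat; lra.
rewrite (_ : (_ + _)%R = 0%R); last by rewrite Rmult_assoc -/(c n); field; lra.
rewrite Rpower_O; last lra.
by apply: (le_INR 1); apply/leP/card_gt0P; exists (d_init D).
Qed.
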